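(* Let $M$ be a closed subset of a normed space $X$, and let $S,T:M\to M$ be such that $M=S(M)$. Let $\phi:[0,\infty)\to[0,\infty)$ be Lebesgue measurable, Lebesgue summable on each compact subset of $[0,\infty)$, with $\int_0^\epsilon\phi(t)\,dt>0$ for all $\epsilon>0$. Let $\gamma:(0,\infty)\to(0,\infty)$ be nondecreasing with $\gamma(t)<t$ for all $t>0$, with the convention $\gamma(0)=0$. Suppose that $M$ has a contractive jointly continuous family $\Im=\{f_x:x\in M\}$, that the ordered pair $(S,T)$ is a generalized $\mathcal{JH\Im}$-suboperator pair with order $n_0\in\mathbb{N}$, and that for all $x,y\in M$, all functions $\Phi:(0,1)\to(0,1)$ and all $s\in(0,1)$, $$\psi\Big(\int_0^{\|Tx-Ty\|}\phi(t)\,dt\Big)\le F\Big(\psi\Big(\int_0^{\frac1{\Phi(s)}\gamma(m_4(x,y))}\phi(t)\,dt\Big),\ \varphi\Big(\int_0^{\frac1{\Phi(s)}\gamma(m_4(x,y))}\phi(t)\,dt\Big)\Big),$$ where, with $Y_{f_{Tx}(0)}^{Tx}=\{f_{Tx}(k):k\in[0,1]\}$, $$m_4(x,y)=\max\Big\{\|Sx-Sy\|,\ \mathrm{dist}(Sx,Y_{f_{Tx}(0)}^{Tx}),\ \mathrm{dist}(Sy,Y_{f_{Ty}(0)}^{Ty}),\ \tfrac12\big[\mathrm{dist}(Sx,Y_{f_{Ty}(0)}^{Ty})+\mathrm{dist}(Sy,Y_{f_{Tx}(0)}^{Tx})\big]\Big\},$$ and $\psi\in\Psi$, $\varphi\in\Phi_u$,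 $F\in\mathcal{C}$ are such that $(\psi,\varphi,F)$ is monotone. Then $M\cap\mathrm{Fix}(S)\cap\mathrm{Fix}(T)\ne\emptyset$ provided one of the following conditions holds: (3a) $cl(T(M))$ is compact and $S$ and $T$ are continuous; (3b) $M$ is bounded, $T$ and $S$ are continuous and $S$ is hemicompact; (3c) $wcl(T(M))$ is weakly compact, $S$ is weakly continuous and $S-T$ is demiclosed at $0$.
   Context: $\mathrm{Fix}(T)$ is the set of fixed points of $T$; $cl(A)$, $wcl(A)$ are the closure and weak closure of $A$; $\delta(A)$ is the diameter of $A$; $\mathrm{dist}(z,A)=\inf_{a\in A}\|z-a\|$. A family on $M$ is $\Im=\{f_\alpha\}_{\alpha\in M}$ with $f_\alpha:[0,1]\to M$ and $f_\alpha(1)=\alpha$ for each $\alpha\in M$. It is contractive if there is a function $\Phi_0:(0,1)\to(0,1)$ with $\|f_\alpha(t)-f_\beta(t)\|\le\Phi_0(t)\|\alpha-\beta\|$ for all $\alpha,\beta\in M$, $t\in(0,1)$. It is jointly continuous if $t\to t_0$ in $[0,1]$ and $\alpha\to\alpha_0$ in $M$ imply $f_\alpha(t)\to f_{\alpha_0}(t_0)$ in $M$. For self-maps $S,R$ of $M$, $PC(S,R)=\{w:\ w=Sx=Rx\text{ for some }x\in M\}$. $(S,T)$ is a generalized $\mathcal{JH\Im}$-suboperator pair with order $n\in\mathbb{N}$ ($n\ge1$) if for each $k\in[0,1]$ there exist $x\in M$ and $w=Sx=T_kx\in PC(S,T_k)$ with $\|w-x\|\le(\delta(PC(S,T_k)))^n$,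 where $T_k:M\to M$, $T_kx=f_{Tx}(k)$. A map $R:M\to M$ is hemicompact if any sequence $\{x_n\}$ in $M$ with $\|x_n-Rx_n\|\to0$ has a convergent subsequence. A map $G$ from $M$ to $X$ is demiclosed at $0$ if whenever $\{x_n\}\subseteq M$ converges weakly to $x$ and $\{Gx_n\}$ converges to $0$, then $Gx=0$. $\Psi$ is the set of altering distance functions: continuous non-decreasing $\psi:[0,\infty)\to[0,\infty)$ with $\psi(t)=0$ iff $t=0$. $\Phi_u$ is the set of ultra altering distance functions: continuous nondecreasing $\varphi:[0,\infty)\to[0,\infty)$ with $\varphi(t)>0$ for $t>0$ (and $\varphi(0)\ge0$). $\mathcal{C}$ is the set of $C$-class functions: continuous $F:[0,\infty)^2\to\mathbb{R}$ such that for all $s,t\ge0$: $F(s,t)\le s$, and $F(s,t)=s$ implies $s=0$ or $t=0$. The triple $(\psi,\varphi,F)$ is monotone if for all $x,y\in[0,\infty)$, $x\le y$ implies $F(\psi(x),\varphi(x))\le F(\psi(y),\varphi(y))$. *)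

(* Defs.v *)
From HB Require Import structures.
From mathcomp Require Import all_boot all_order all_algebra.
From mathcomp Require Import all_classical all_reals all_analysis.
Set Implicit Arguments.
Unset Strict Implicit.
Unset Printing Implicit Defensive.
Import Order.TTheory GRing.Theory Num.Theory.
Import numFieldNormedType.Exports.
Local Open Scope classical_set_scope.
Local Open Scope ring_scope.

(* Functions whose domain is a proper subset (a subset M of a normed space,
   [0, +oo[, [0, 1], ...) are total functions whose values outside of that
   domain are never constrained: every hypothesis is relative to the domain. *)

Section metric_notions.
Context {R : realType} {X : normedModType R}.
Implicit Types (A M : set X) (S T : X -> X) (f : X -> R -> X).

Definition dist (z : X) A : R := inf [set `|z - a| | a in A].

(* Extended-real valued, since A may be unbounded. *)
Definition diam A : \bar R :=
  ereal_sup [set `|x - y|%:E | x in A & y in A].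

Definition fixed_points S : set X := [set x | S x = x].

Definition is_family M f : Prop :=
  forall a, M a -> (forall t, 0 <= t <= 1 -> M (f a t)) /\ f a 1 = a.

Definition contractive_family M f : Prop :=
  exists Phi0 : R -> R,
    (forall t, 0 < t < 1 -> 0 < Phi0 t < 1) /\
    (forall a b t, M a -> M b -> 0 < t < 1 ->
      `|f a t - f b t| <= Phi0 t * `|a - b|).

Definition jointly_continuous_family M f : Prop :=
  {within M `*` `[0, 1], continuous (fun p : X * R => f p.1 p.2)}.

(* PC(S, R): the points of coincidence on M. *)
Definition PC M S T : set X :=
  [set w | exists x, [/\ M x, w = S x & w = T x]].

(* T_k *)
Definition family_map f T (k : R) : X -> X := fun x => f (T x) k.

(* Y_{f_{Tx}(0)}^{Tx} is the value of this set at a = T x. *)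
Definition family_path f (a : X) : set X := [set f a k | k in `[0, 1]].

Definition generalized_JH_suboperator_pair M f S T (n : nat) : Prop :=
  forall k, 0 <= k <= 1 ->
    exists x w, [/\ M x, w = S x, w = family_map f T k x,
                    PC M S (family_map f T k) w &
                    (`|w - x|%:E <= diam (PC M S (family_map f T k)) ^+ n)%E].

Definition m4 f S T (x y : X) : R :=
  let Yx := family_path f (T x) in
  let Yy := family_path f (T y) in
  Num.max `|S x - S y|
    (Num.max (dist (S x) Yx)
      (Num.max (dist (S y) Yy)
        (2^-1 * (dist (S x) Yy + dist (S y) Yx)))).

Definition hemicompact M S : Prop :=
  forall u : nat -> X, (forall n, M (u n)) ->
    (`|u n - S (u n)| @[n --> \oo] --> (0 : R)) ->
    exists s : nat -> nat, {homo s : i j / (i < j)%N} /\ cvgn (u \o s).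

End metric_notions.

Section weak_topology.
Context {R : realType}.

Definition continuous_dual (X : normedModType R) : Type :=
  {l : {linear X -> R^o} | continuous (l : X -> R^o)}.

Definition dual_eval (X : normedModType R) (x : X) :
  prod_topology (fun _ : continuous_dual X => R) := fun l => sval l x.

(* X with the coarsest topology making all continuous linear functionals
   continuous. *)
Definition weak (X : normedModType R) : topologicalType :=
  initial_topology (@dual_eval X).

Context {X : normedModType R}.
Implicit Types (A M : set X) (S G : X -> X).

Definition weak_closure A : set X := closure (A : set (weak X)).

Definition weakly_compact A : Prop := compact (A : set (weak X)).

Definition weakly_continuous M S : Prop :=
  {within (M : set (weak X)), continuous (S : weak X -> weak X)}.

Definition demiclosed0 M G : Prop :=
  forall (u : nat -> X) (x : X), (forall n, M (u n)) -> M x ->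
    ((u : nat -> weak X) @ \oo --> (x : weak X)) ->
    (G (u n) @[n --> \oo] --> (0 : X)) ->
    G x = 0.

End weak_topology.

Section control_functions.
Context {R : realType}.
Implicit Types (psi phi gamma : R -> R) (F : R -> R -> R).

Definition altering_distance psi : Prop :=
  [/\ forall t, 0 <= t -> 0 <= psi t,
      {within `[0, +oo[, continuous psi},
      forall s t, 0 <= s -> s <= t -> psi s <= psi t &
      forall t, 0 <= t -> (psi t = 0 <-> t = 0)].

Definition ultra_altering_distance phi : Prop :=
  [/\ forall t, 0 <= t -> 0 <= phi t,
      {within `[0, +oo[, continuous phi},
      forall s t, 0 <= s -> s <= t -> phi s <= phi t &
      forall t, 0 < t -> 0 < phi t].

Definition C_class F : Prop :=
  [/\ {within `[0, +oo[ `*` `[0, +oo[, continuous (fun p : R * R => F p.1 p.2)},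
      forall s t, 0 <= s -> 0 <= t -> F s t <= s &
      forall s t, 0 <= s -> 0 <= t -> F s t = s -> s = 0 \/ t = 0].

Definition monotone_triple psi phi F : Prop :=
  forall x y, 0 <= x -> 0 <= y -> x <= y ->
    F (psi x) (phi x) <= F (psi y) (phi y).

(* The library's default sigma-algebra on R is the Borel one; Lebesgue
   measurability is measurability for the domain of the completed measure. *)
Definition lebesgue_int phi (a : R) : R :=
  \int[completed_lebesgue_measure]_(t in `[0, a]) phi t.

Definition integral_kernel phi : Prop :=
  [/\ forall t, 0 <= t -> 0 <= phi t,
      measurable_fun
        (`[0, +oo[ : set (caratheodory_type ((wlength (@idfun R))^*)%mu)) phi,
      forall K : set R, compact K -> K `<=` `[0, +oo[ ->
        completed_lebesgue_measure.-integrable K (EFin \o phi) &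
      forall e, 0 < e -> 0 < lebesgue_int phi e].

Definition gamma_function gamma : Prop :=
  [/\ forall t, 0 < t -> 0 < gamma t,
      forall s t, 0 < s -> s <= t -> gamma s <= gamma t,
      forall t, 0 < t -> gamma t < t &
      gamma 0 = 0].

End control_functions.

(* Main.v *)
(* At k = 1 the family gives T_1 = T, so the pair hypothesis provides a point x
   with w = S x = T x and |w - x| at most a power of the diameter of the set of
   points of coincidence of S and T.  That set has at most one element: if
   d = |w - w'| > 0 for two of its elements w = S x = T x and w' = S y = T y,
   then m4(x, y) = d, and taking Phi constantly equal to gamma(d) / d turns the
   contraction inequality into psi(I d) <= F (psi(I d)) (varphi(I d)), where
   I d > 0 is the integral of phi over [0, d]; this forces psi(I d) = 0 or
   varphi(I d) = 0.  So the diameter vanishes and x = w = S x = T x. *)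

Require Import Defs.
From HB Require Import structures.
From mathcomp Require Import all_boot all_order all_algebra.
From mathcomp Require Import all_classical all_reals all_analysis.
Set Implicit Arguments.
Unset Strict Implicit.
Unset Printing Implicit Defensive.
Import Order.TTheory GRing.Theory Num.Theory.
Import numFieldNormedType.Exports.
Local Open Scope classical_set_scope.
Local Open Scope ring_scope.

Lemma dist_le (R : realType) (X : normedModType R) (z a : X) (A : set X) :
  A a -> dist z A <= `|z - a|.
Proof.
move=> Aa; apply: ge_inf; last by exists a.
by exists 0 => _ [b _ <-]; exact: normr_ge0.
Qed.

Lemma family_path_end (R : realType) (X : normedModType R) (M : set X)
    (f : X -> R -> X) (a : X) :
  is_family M f -> M a -> family_path f a a.
Proof.
move=> fM Ma; exists 1; last by have [] := fM a Ma.
by rewrite /= in_itv /= ler01 lexx.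
Qed.

Lemma diam_set1 (R : realType) (X : normedModType R) (x : X) :
  diam [set x] = 0%E.
Proof.
rewrite /diam (_ : [set _ | _ in _ & _ in _] = [set 0%E]) ?ereal_sup1//.
apply/seteqP; split => [_ [_ -> [_ -> <-]]|_ ->] /=.
  by rewrite subrr normr0.
by exists x => //; exists x => //; rewrite subrr normr0.
Qed.

(** Each path ends at its own base point (parameter 1). Hence [T x] and [T y] are at distance at
    most 0 from their own paths and at most [|T x - T y|] from each other's, so the first term of
    the maximum dominates. *)
Lemma m4_coincidence (R : realType) (X : normedModType R) (M : set X)
    (f : X -> R -> X) (S T : X -> X) (x y : X) :
  is_family M f -> M (T x) -> M (T y) -> S x = T x -> S y = T y ->
  m4 f S T x y = `|T x - T y|.
Proof.
move=> fM MTx MTy Sx Sy; rewrite /m4 Sx Sy; apply/max_idPl.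
have Yx := family_path_end fM MTx; have Yy := family_path_end fM MTy.
have dxx := dist_le (T x) Yx; have dyy := dist_le (T y) Yy.
have dxy := dist_le (T x) Yy; have dyx := dist_le (T y) Yx.
rewrite subrr normr0 in dxx; rewrite subrr normr0 in dyy.
rewrite distrC in dyx; have d0 := normr_ge0 (T x - T y).
rewrite !ge_max; apply/and3P; split; [exact: le_trans d0..|].
by rewrite mulrC ler_pdivrMr// mulr_natr mulr2n lerD.
Qed.

(** Equality would force [psi t = 0] or [varphi t = 0], both excluded for positive [t]. *)
Lemma C_class_lt (R : realType) (psi varphi : R -> R) (F : R -> R -> R)
    (t : R) :
  altering_distance psi -> ultra_altering_distance varphi -> C_class F ->
  0 < t -> F (psi t) (varphi t) < psi t.
Proof.
move=> [psi0 _ _ psi_eq0] [varphi0 _ _ varphi_gt0] [_ F_le F_eq] t0.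
have tge0 := ltW t0.
rewrite lt_neqAle F_le ?andbT; [|exact: psi0|exact: varphi0].
apply/eqP => /F_eq[|||/eqP]; [exact: psi0|exact: varphi0| |].
  by move/(psi_eq0 _ tge0) => te0; rewrite te0 ltxx in t0.
by rewrite gt_eqF ?varphi_gt0.
Qed.

Theorem theorem4p9 (R : realType) (X : normedModType R) (M : set X)
    (S T : X -> X) (phi gamma : R -> R) (f : X -> R -> X) (n0 : nat)
    (psi varphi : R -> R) (F : R -> R -> R)
    (Mclosed : closed M)
    (S_self : forall x, M x -> M (S x))
    (T_self : forall x, M x -> M (T x))
    (S_onto : M = S @` M)
    (phiP : integral_kernel phi)
    (gammaP : gamma_function gamma)
    (f_family : is_family M f)
    (f_contractive : contractive_family M f)
    (f_continuous : jointly_continuous_family M f)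
    (n0_gt0 : (0 < n0)%N)
    (ST_pair : generalized_JH_suboperator_pair M f S T n0)
    (psiP : altering_distance psi)
    (varphiP : ultra_altering_distance varphi)
    (FP : C_class F)
    (monotoneP : monotone_triple psi varphi F)
    (contraction : forall x y, M x -> M y ->
      forall Phi : R -> R, (forall t, 0 < t < 1 -> 0 < Phi t < 1) ->
      forall s, 0 < s < 1 ->
      psi (lebesgue_int phi `|T x - T y|) <=
      F (psi (lebesgue_int phi ((Phi s)^-1 * gamma (m4 f S T x y))))
        (varphi (lebesgue_int phi ((Phi s)^-1 * gamma (m4 f S T x y)))))
    (conditions :
      [\/ [/\ compact (closure (T @` M)),
              {within M, continuous S} & {within M, continuous T}],
          [/\ bounded_set M, {within M, continuous T},
              {within M, continuous S} & hemicompact M S] |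
          [/\ weakly_compact (weak_closure (T @` M)),
              weakly_continuous M S &
              demiclosed0 M (fun x => S x - T x)]]) :
  M `&` fixed_points S `&` fixed_points T !=set0.
Proof.
have T1 x : M x -> family_map f T 1 x = T x.
  by move=> Mx; have [] := f_family _ (T_self _ Mx).
have coincidence_unique x y : M x -> M y -> S x = T x -> S y = T y ->
    T x = T y.
  move=> Mx My Sx Sy; apply/eqP; rewrite -subr_eq0 -normr_le0 leNgt.
  apply/negP; set d := `|T x - T y| => d0.
  have [gamma_gt0 _ gamma_lt _] := gammaP; have [_ _ _ int_gt0] := phiP.
  have Phi01 : 0 < gamma d / d < 1.
    by rewrite divr_gt0 ?gamma_gt0//= ltr_pdivrMr ?mul1r ?gamma_lt.
  have half01 : 0 < (2^-1 : R) < 1 by rewrite invr_gt0 invf_lt1 ?ltr0n ?ltr1n.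
  (* Here [m4] equals [d], and dividing [gamma d] by this constant gives back [d], so both sides
     involve the same integral. As [Phi] is constant, 1/2 is an arbitrary choice of [s]. *)
  have := contraction _ _ Mx My (fun=> gamma d / d) (fun _ _ => Phi01) _ half01.
  rewrite (m4_coincidence f_family (T_self _ Mx) (T_self _ My) Sx Sy) -/d.
  rewrite invf_div divfK ?gt_eqF ?gamma_gt0//.
  by rewrite leNgt (C_class_lt psiP varphiP FP (int_gt0 _ d0)).
have [|x [w [Mx wS wT PCw]]] := ST_pair 1; first by rewrite ler01 lexx.
have wTx : w = T x by rewrite wT T1.
(* The membership [PCw] matters: the diameter of the empty set would be -oo, not 0. *)
have -> : PC M S (family_map f T 1) = [set w].
  apply/seteqP; split => [w' [y [My w'S w'T]]|_ ->//].
  rewrite T1// in w'T; rewrite /= w'T wTx.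
  by apply: coincidence_unique => //; [rewrite -w'S|rewrite -wS].
(* A positive exponent exposes a factor 0; a zeroth power would be 1 and would not force [w = x]. *)
rewrite diam_set1 -(prednK n0_gt0) expeS mul0e lee_fin normr_le0 subr_eq0 => /eqP wx.
by exists x; split; [split|] => //; rewrite /fixed_points /= -?wS -?wTx.
Qed.
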